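(* Let $\Delta$ be a disk diagram with $V^\circ\neq\varnothing$. Let $f:V^\circ\to\mathbb R$ be a nonnegative first Dirichlet eigenfunction for $\lambda_1=\lambda_1(\Delta)$, extended by $0$ to $V(\partial\Delta)$, and normalised so that $f(v_0)=1$ at a maximising vertex $v_0\in V^\circ$. Let $\Gamma_{\mathrm{esc}}$ be the family of all edge paths in $\Delta^{(1)}$ from $v_0$ to $V(\partial\Delta)$. Then $$\mathrm{EL}(\Gamma_{\mathrm{esc}})\ge\frac{1}{\lambda_1\cdot\mathrm{vol}(V^\circ)}.$$
   Context: A disk diagram $\Delta$ is a finite, connected, simply connected planar $2$-complex with boundary walk $\partial\Delta$; its $1$-skeleton $\Delta^{(1)}$ may have multi-edges but no loop edges; $V^\circ=V(\Delta)\setminus V(\partial\Delta)$; $\deg(v)$ counts edge incidences with multiplicity; $\mathrm{vol}(A)=\sum_{v\in A}\deg(v)$. $\lambda_1(\Delta)=\inf_{f\not\equiv0}\dfrac{\sum_{e\in E(\Delta)}(\widetilde f(e^+)-\widetilde f(e^-))^2}{\sum_{v\in V^\circ}\deg(v)f(v)^2}$ over $f:V^\circ\to\mathbb R$, $\widetilde f$ the extension by $0$ to $V(\partial\Delta)$; equivalently the smallest eigenvalue of $\mathcal L=I-P$ on $\ell^2(V^\circ,\deg)$, where $(Pf)(v)=\deg(v)^{-1}\sum_{e:v\sim u,\,u\in V^\circ}f(u)$ (sum over edges incident to $v$ with multiplicity). A first Dirichlet eigenfunction is a nonzero $f$ with $\mathcal Lf=\lambda_1f$. For a family $\Gamma$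 of edge paths in a finite graph $(V,E)$, an admissible metric is $m:E\to[0,\infty)$ with $\sum_{e\in\gamma}m(e)\ge1$ for all $\gamma\in\Gamma$, and $\mathrm{EL}(\Gamma)=\sup_m1/\mathcal A(m)$ over admissible $m$, where $\mathcal A(m)=\sum_{e\in E}m(e)^2$. *)

(* Defs.v *)
From HB Require Import structures.
From mathcomp Require Import all_boot all_order all_fingroup all_algebra.
From mathcomp Require Import boolp classical_sets reals ereal.

Set Implicit Arguments.
Unset Strict Implicit.
Unset Printing Implicit Defensive.
Import Order.TTheory GRing.Theory Num.Theory.
Local Open Scope ring_scope.

(** * Finite multigraphs and edge paths *)

(* [tail] and [head] are the endpoints e^- and e^+ for an arbitrary but fixed
   orientation of every edge. *)
Record multigraph := Multigraph {
  vertex : finType;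
  edge : finType;
  tail : edge -> vertex;
  head : edge -> vertex
}.

(* [(e, false)] is [e] traversed from e^- to e^+, [(e, true)] the reverse. *)
Definition dart (G : multigraph) : finType := (edge G * bool)%type.

Section Multigraph.
Variable G : multigraph.
Implicit Types (d : dart G) (p : seq (dart G)) (x y v : vertex G).

Definition src d : vertex G := if d.2 then head d.1 else tail d.1.
Definition rev d : dart G := (d.1, ~~ d.2).
Definition tgt d : vertex G := src (rev d).

(* Edge paths may repeat vertices and edges. *)
Fixpoint edge_path x p y : bool :=
  if p is d :: p' then (src d == x) && edge_path (tgt d) p' y else x == y.

Definition deg v : nat := #|[set d : dart G | src d == v]%SET|.
Definition vol (A : {set vertex G}) : nat := (\sum_(v in A) deg v)%N.

End Multigraph.

(** * Disk diagrams *)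

(* A finite connected graph drawn in the sphere is encoded by its rotation
   system: [next] sends a dart to its successor along the boundary of the face
   lying on a fixed side of it.  The faces are the orbits of [next], except that
   the one-vertex graph without edges has a single face, with no darts. *)
Definition faces (G : multigraph) (next : {perm (dart G)}) :
    {set {set (dart G)}} :=
  if #|edge G| == 0%N then [set finset.set0]%SET else porbits next.

(* [c] is one turn around the boundary of the face [F], from some dart of [F]. *)
Definition traverses (G : multigraph) (next : {perm (dart G)})
    (c : seq (dart G)) (F : {set (dart G)}) : bool :=
  [&& uniq c, fcycle next c & [set d in c]%SET == F].

(* Homotopy rel endpoints of edge paths starting at [x], in the 2-complex with
   2-cells [cells]. *)
Inductive homotopic (G : multigraph) (next : {perm (dart G)})
    (cells : {set {set (dart G)}}) (x : vertex G) :
    seq (dart G) -> seq (dart G) -> Prop :=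
| Homotopic_refl p : homotopic next cells x p p
| Homotopic_sym p q :
    homotopic next cells x p q -> homotopic next cells x q p
| Homotopic_trans p q r :
    homotopic next cells x p q -> homotopic next cells x q r ->
    homotopic next cells x p r
| Homotopic_spur p d q y :
    edge_path x (p ++ d :: rev d :: q) y ->
    homotopic next cells x (p ++ d :: rev d :: q) (p ++ q)
| Homotopic_cell p c F q y :
    F \in cells -> traverses next c F ->
    edge_path x (p ++ c ++ q) y ->
    homotopic next cells x (p ++ c ++ q) (p ++ q).

(* [rotation] says that the darts issuing from a vertex are cyclically permuted
   by [d |-> next (rev d)], and [euler] that the resulting closed surface is a
   sphere.  The complement of the outer face is identified with the plane, so
   the 2-cells are faces other than the outer one. *)
Record disk_diagram := DiskDiagram {
  skeleton :> multigraph;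
  next : {perm (dart skeleton)};
  cells : {set {set (dart skeleton)}};
  outer : {set (dart skeleton)};
  base : vertex skeleton;
  bwalk : seq (dart skeleton);
  no_loop : forall e : edge skeleton, tail e != head e;
  next_src : forall d : dart skeleton, src (next d) = tgt d;
  rotation : forall d d' : dart skeleton,
    src d = src d' -> fconnect (fun a => next (rev a)) d d';
  connected : forall x y : vertex skeleton, exists p, edge_path x p y;
  euler : (#|vertex skeleton| + #|faces next| = #|edge skeleton| + 2)%N;
  cells_sub : cells \subset faces next;
  outer_face : outer \in faces next;
  outer_not_cell : outer \notin cells;
  simply_connected : forall (x : vertex skeleton) (p : seq (dart skeleton)),
    edge_path x p x -> homotopic next cells x p [::];
  bwalk_closed : edge_path base bwalk base;
  bwalk_outer : traverses next bwalk outer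
}.

Section DiskDiagram.
Variable D : disk_diagram.

Definition Vbnd : {set vertex D} :=
  [set v in base D :: [seq tgt d | d <- bwalk D]]%SET.

Definition Vint : {set vertex D} := (~: Vbnd)%SET.

Definition ivertex : finType := {v : vertex D | v \in Vint}.

Variable R : realType.

Definition ext (f : ivertex -> R) (v : vertex D) : R :=
  if insub v is Some u then f u else 0.

Definition rayleigh (f : ivertex -> R) : R :=
  (\sum_(e : edge D) (ext f (head e) - ext f (tail e)) ^+ 2) /
  (\sum_(v : ivertex) (deg (val v))%:R * f v ^+ 2).

Definition lambda1 : R :=
  inf [set r | exists2 f : ivertex -> R,
                 (exists v, f v != 0) & r = rayleigh f]%classic.

Definition transition (f : ivertex -> R) (v : ivertex) : R :=
  (deg (val v))%:R^-1 *
  \sum_(d : dart D | (src d == val v) && (tgt d \in Vint)) ext f (tgt d).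

Definition laplacian (f : ivertex -> R) (v : ivertex) : R :=
  f v - transition f v.

Definition first_dirichlet_eigenfunction (f : ivertex -> R) : Prop :=
  (exists v, f v != 0) /\ (forall v, laplacian f v = lambda1 * f v).

End DiskDiagram.

Arguments lambda1 D R : clear implicits.

(** * Extremal length *)

Section ExtremalLength.
Variables (R : realType) (G : multigraph).

(* Edges are counted as often as the path traverses them. *)
Definition path_length (m : edge G -> R) (p : seq (dart G)) : R :=
  \sum_(d <- p) m d.1.

Definition admissible (Gamma : set (seq (dart G))) (m : edge G -> R) : Prop :=
  (forall e, 0 <= m e) /\ (forall p, Gamma p -> 1 <= path_length m p).

Definition area (m : edge G -> R) : R := \sum_(e : edge G) m e ^+ 2.

(* In [\bar R] the inverse of 0 is [+oo]. *)
Definition EL (Gamma : set (seq (dart G))) : \bar R :=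
  ereal_sup [set x | exists2 m, admissible Gamma m
                                & x = ((area m)%:E^-1)%E]%classic.

End ExtremalLength.

Definition Gamma_esc (D : disk_diagram) (v0 : vertex D) : set (seq (dart D)) :=
  [set p | exists2 y, y \in Vbnd D & edge_path v0 p y]%classic.

(* Main.v *)
Require Import Defs.
From HB Require Import structures.
From mathcomp Require Import all_boot all_order all_fingroup all_algebra.
From mathcomp Require Import boolp classical_sets reals ereal.

(** Extremal length is a supremum over admissible metrics, so one good metric
    gives a lower bound.  The metric is the gradient of the eigenfunction,
    [m e = |f(e^+) - f(e^-)|].  Along an escaping path the increments of [f]
    telescope from [f v0 = 1] to the boundary value [0], so every such path has
    length at least [1] ([increment_le_path_length]).  The area of [m] is the
    Dirichlet energy of [f]; by Green's identity ([dirichlet_energyE]) and the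
    eigenvalue equation it equals [lambda1 * \sum_v deg v * f v ^+ 2]
    ([eigenfunction_energy]), which is at most [lambda1 * vol Vint] because
    [0 <= f <= 1] and [lambda1 >= 0].  Inversion reverses the inequality, also
    for area [0], whose inverse is [+oo]. *)

Set Implicit Arguments.
Unset Strict Implicit.
Unset Printing Implicit Defensive.
Import Order.TTheory GRing.Theory Num.Theory.
Local Open Scope ring_scope.

Section Gradient.
Variables (R : realType) (G : multigraph) (F : vertex G -> R).

Definition gradient_metric (e : edge G) : R := `|F (Defs.head e) - F (tail e)|.

Lemma gradient_metric_dart (d : dart G) :
  gradient_metric d.1 = `|F (src d) - F (tgt d)|.
Proof. by case: d => e []; rewrite /gradient_metric // distrC. Qed.

Lemma increment_le_path_length (x y : vertex G) (p : seq (dart G)) :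
  edge_path x p y -> F x - F y <= path_length gradient_metric p.
Proof.
elim: p x => [|d p IHp] x /=.
  by move=> /eqP ->; rewrite /path_length big_nil subrr.
move=> /andP[/eqP <- /IHp le_p].
rewrite /path_length big_cons gradient_metric_dart.
rewrite -(subrKA (F (tgt d))) lerD //; exact: ler_norm.
Qed.

Lemma area_gradient_metric :
  area gradient_metric = \sum_(e : edge G) (F (Defs.head e) - F (tail e)) ^+ 2.
Proof. by apply: eq_bigr => e _; rewrite real_normK ?num_real. Qed.

(** Green's identity: each edge term [(a - b) ^+ 2] splits as
    [a * (a - b) + b * (b - a)], one summand for each of its two darts, and the
    darts are then grouped by source. *)
Lemma dirichlet_energyE :
  \sum_(e : edge G) (F (Defs.head e) - F (tail e)) ^+ 2 =
  \sum_(v : vertex G)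
    F v * ((deg v)%:R * F v - \sum_(d : dart G | src d == v) F (tgt d)).
Proof.
transitivity (\sum_(d : dart G) F (src d) * (F (src d) - F (tgt d))).
  rewrite (eq_bigr (fun d => (fun e b => F (src (e, b)) *
    (F (src (e, b)) - F (tgt (e, b)))) d.1 d.2)); last by case.
  rewrite -(pair_bigA _ (fun e b => F (src (e, b)) *
    (F (src (e, b)) - F (tgt (e, b))))) /=.
  apply: eq_bigr => e _; rewrite big_bool /src /tgt /src /=.
  by rewrite -[F (tail e) - _]opprB mulrN -mulrBl expr2.
rewrite (partition_big (@src G) xpredT) //=; apply: eq_bigr => v _.
rewrite (eq_bigr (fun d => F v * (F v - F (tgt d)))); last by move=> d /eqP ->.
rewrite -mulr_sumr sumrB sumr_const mulr_natl; congr (_ * (_ *+ _ - _)).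
by rewrite /deg cardsE.
Qed.

End Gradient.

Section Dirichlet.
Variables (R : realType) (D : disk_diagram).
Implicit Type f : ivertex D -> R.

Lemma ext_val f (v : ivertex D) : ext f (val v) = f v.
Proof. by rewrite /ext valK. Qed.

Lemma ext_out f (x : vertex D) : x \notin Vint D -> ext f x = 0.
Proof. by move=> xV; rewrite /ext insubN. Qed.

Lemma sum_ivertex (h : vertex D -> R) :
  \sum_(v : ivertex D) h (val v) = \sum_(x in Vint D) h x.
Proof. by rewrite [RHS]big_sub. Qed.

(** Every Rayleigh quotient is nonnegative; the nonzero [f] is there to make the
    set of quotients nonempty, which its infimum requires. *)
Lemma lambda1_ge0 f : (exists v, f v != 0) -> 0 <= lambda1 D R.
Proof.
move=> f_neq0; apply: lb_le_inf; first by exists (rayleigh f), f.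
move=> _ [g _ ->]; apply: divr_ge0; apply: sumr_ge0 => i _; first exact: sqr_ge0.
by rewrite mulr_ge0 ?sqr_ge0.
Qed.

(** Puts the Laplacian in the form in which it occurs in Green's identity.  A
    vertex of degree [0] has no darts, so both sides vanish there. *)
Lemma deg_laplacian f (v : ivertex D) :
  (deg (val v))%:R * laplacian f v =
  (deg (val v))%:R * f v - \sum_(d : dart D | src d == val v) ext f (tgt d).
Proof.
rewrite mulrBr /transition mulrA; congr (_ - _).
(* Darts that end on the boundary contribute [0] to the right-hand sum. *)
rewrite [RHS](bigID (fun d => tgt d \in Vint D)) /= [X in _ + X]big1; last first.
  by move=> d /andP[_ /ext_out].
have [deg0|deg_neq0] := eqVneq (deg (val v)) 0%N.
  rewrite addr0 deg0 mul0r mul0r big1 // => d /andP[srcd _].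
  move: deg0 => /eqP; rewrite /deg cards_eq0 => /eqP/setP/(_ d).
  by rewrite !inE srcd.
by rewrite addr0 mulfV ?mul1r // pnatr_eq0.
Qed.

(** Green's identity pairs [ext f] with its Laplacian; boundary vertices drop out
    because [ext f] vanishes there, and at interior ones the Laplacian is
    [c * f v]. *)
Lemma eigenfunction_energy f (c : R) :
  (forall v, laplacian f v = c * f v) ->
  \sum_(e : edge D) (ext f (Defs.head e) - ext f (tail e)) ^+ 2 =
  c * \sum_(v : ivertex D) (deg (val v))%:R * f v ^+ 2.
Proof.
move=> eig; rewrite dirichlet_energyE (bigID (mem (Vint D))) /=.
rewrite [X in _ + X]big1 ?addr0; last by move=> x /ext_out ->; rewrite mul0r.
rewrite -sum_ivertex mulr_sumr; apply: eq_bigr => v _.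
by rewrite ext_val -deg_laplacian eig expr2 mulrCA mulrA mulrCA !mulrA.
Qed.

Lemma weighted_norm_le_vol f : (forall v, 0 <= f v <= 1) ->
  \sum_(v : ivertex D) (deg (val v))%:R * f v ^+ 2 <= (vol (Vint D))%:R.
Proof.
move=> f01; rewrite /vol natr_sum -sum_ivertex; apply: ler_sum => v _.
by have /andP[f_ge0 f_le1] := f01 v; rewrite ler_piMr ?exprn_ile1.
Qed.

End Dirichlet.

Theorem theorem3p1 (R : realType) (D : disk_diagram)
    (hV : Vint D != finset.set0)
    (f : ivertex D -> R) (hf : first_dirichlet_eigenfunction f)
    (f_ge0 : forall v : ivertex D, 0 <= f v)
    (v0 : ivertex D) (f_max : forall v : ivertex D, f v <= f v0)
    (f_v0 : f v0 = 1) :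
  (((lambda1 D R * (vol (Vint D))%:R)%:E)^-1
     <= EL R (Gamma_esc (val v0)))%E.
Proof.
have [f_neq0 eig] := hf; pose m := gradient_metric (ext f).
have adm_m : admissible (Gamma_esc (val v0)) m.
  split=> [e|p [y y_bnd path_p]]; first exact: normr_ge0.
  have := increment_le_path_length (ext f) path_p.
  by rewrite ext_val f_v0 (@ext_out _ _ f y) ?subr0 // inE y_bnd.
apply: (@le_trans _ _ ((area m)%:E^-1)%E); last by apply: ereal_sup_ubound; exists m.
have area_ge0 : 0 <= area m by apply: sumr_ge0 => e _; exact: sqr_ge0.
have lambda_ge0 : 0 <= lambda1 D R := lambda1_ge0 f_neq0.
rewrite lee_pV2 ?inE ?lee_fin ?mulr_ge0 //.
rewrite area_gradient_metric (eigenfunction_energy eig).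
apply: ler_wpM2l; first exact: lambda_ge0.
by apply: weighted_norm_le_vol => v; rewrite f_ge0 -f_v0 f_max.
Qed.
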